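(* Let $\mathcal{A}$ be an associative $\mathbb{Z}^n$-graded commutative unital algebra. For any fixed $\alpha\in\mathbb{Z}^n$, any $A\in\mathfrak{Diff}_1^{(A+\alpha a,a)}(\mathcal{A})$ and any $B\in\mathfrak{Diff}_1^{(B+\alpha b,b)}(\mathcal{A})$, the Grabowski-Marmo bracket is given by $$[A,B]^{\mathrm{GM}}=A\square B-(-1)^{\langle A+\alpha a,B+\alpha b\rangle+ab}B\square A,$$ where $A\square B$ is defined inductively by $$v\square w:=0,\qquad A\square v:=(-1)^{1-a}A(v)\ (a\ge0),\qquad v\square A:=0\ (a\ge0),$$ $$(A\square B)(v):=(-1)^aA\square B(v)+(-1)^{\langle B+\alpha b,v-\alpha\rangle}A(v)\square B\quad(a,b\ge0),$$ for any $v\in\mathcal{A}^v$, $w\in\mathcal{A}$. Further, the explicit form of the square-product is $$(A\square B)(v_1,\ldots,v_{a+b+1})=(-1)^{1+ab}\sum_{\substack{I\cup J=N^{(a+b+1)}\\ |I|=b+1,\,|J|=a}}(-1)^{(I;J)}\varepsilon_{\downarrow V}(I;J)\,A(B(V_I),V_J),$$ where $v_i\in\mathcal{A}^{v_i}$, $\downarrow V=\downarrow v_1\otimes\ldots\otimes\downarrow v_{a+b+1}$, and $\downarrow v_i\in\mathcal{A}^{v_i-\alpha}$ (i.e. $\downarrow v_i$ is $v_i$ considered with shifted degree $v_i-\alpha$).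
   Context: Vector spaces are over a field $\mathbb{K}$ of characteristic $0$; $\langle\alpha,\beta\rangle=\sum_i\alpha_i\beta_i$ for $\alpha,\beta\in\mathbb{Z}^n$. A homogeneous vector or map and its degree/weight are denoted by the same symbol. Graded commutative means $vw=(-1)^{\langle v,w\rangle}wv$. For $a\ge0$, $\mathfrak{M}^{(A+\alpha a,a)}(\mathcal{A})$ is the space of $(a+1)$-linear maps $\mathcal{A}^{\times(a+1)}\to\mathcal{A}$ of weight $A\in\mathbb{Z}^n$; for $a=-1$ it is $\mathcal{A}^A$ (so $v\in\mathcal{A}^v$ has bidegree $(v-\alpha,-1)$). For an $(a+1)$-linear map $A$ and $v\in\mathcal{A}$, $A(v)$ denotes the $a$-linear map $A(v,-,\ldots,-)$. A multilinear map is $\alpha$-antisymmetric if exchanging adjacent homogeneous arguments $v,w$ produces the sign $-(-1)^{\langle v+\alpha,w+\alpha\rangle}$. For $a\ge0$, $\mathfrak{Diff}_1^{(A+\alpha a,a)}(\mathcal{A})$ is the subspace of those elements of $\mathfrak{M}^{(A+\alpha a,a)}(\mathcal{A})$ that are $\alpha$-antisymmetric graded first order polydifferential operators, i.e. for fixed homogeneous $v_1,\ldots,v_a$, the map $D=A(v_1,\ldots,v_a,-)$, of weight $D$, satisfies $D(vw)=D(v)w+(-1)^{\langle D,v\rangle}vD(w)-D(1)vw$; for $a=-1$ it is $\mathcal{A}^A$. The Grabowski-Marmo bracket $[-,-]^{\mathrm{GM}}$ on $\mathfrak{Diff}_1(\mathcal{A})=\bigoplus\mathfrak{Diff}_1^{(A+\alpha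 a,a)}(\mathcal{A})$ is the bilinear bracket of bidegree $(0,0)$ determined inductively by: $[v,w]^{\mathrm{GM}}=0$; $[A,v]^{\mathrm{GM}}=(-1)^{1-a}A(v)$; $[v,A]^{\mathrm{GM}}=-(-1)^{\langle v-\alpha,A+\alpha a\rangle+a}[A,v]^{\mathrm{GM}}$ ($v,w\in\mathcal{A}$ homogeneous, $a\ge0$); and, for $a,b\ge0$, $$[A,B]^{\mathrm{GM}}(v)=(-1)^a[A,B(v)]^{\mathrm{GM}}+(-1)^{\langle B+\alpha b,v-\alpha\rangle}[A(v),B]^{\mathrm{GM}}.$$ $N^{(p)}=(1,\ldots,p)$; in the sum, $I,J$ are disjoint naturally ordered subsets with the given union (possibly empty; for $a=-1$ the sum is empty, hence $0$); $V_I=(v_{i_1},\ldots,v_{i_{|I|}})$; $(-1)^{(I;J)}$ is the signature of the permutation rearranging $(I;J)$ into increasing order, and $\varepsilon_{\downarrow V}(I;J)$ is the corresponding Koszul sign computed with the degrees $v_i-\alpha$ of $\downarrow v_i$. *)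

(* Defs.v *)
From HB Require Import structures.
From mathcomp Require Import all_boot all_order all_algebra all_fingroup.
From mathcomp Require Import finmap.

Set Implicit Arguments.
Unset Strict Implicit.
Unset Printing Implicit Defensive.

Import GRing.Theory.
Local Open Scope ring_scope.

Definition pairing n (d e : 'rV[int]_n) : int := \sum_i d 0 i * e 0 i.

Definition parity_sign (K : fieldType) (z : int) : K := (-1) ^ z.

(* [hcomp] is the inverse of the summation map from the external direct sum
   of the [homog d], whose elements are the finitely supported families [c]
   with [c d \in homog d], to the whole algebra. *)
Record gradedAlgebra (K : fieldType) (n : nat) := GradedAlgebra {
  galg :> algType K;
  homog : 'rV[int]_n -> {pred galg};
  hcomp : galg -> {fsfun 'rV[int]_n -> galg with 0};
  homog_submod : forall d, submod_closed (homog d);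
  hcomp_homog : forall x d, hcomp x d \in homog d;
  hcomp_sum : forall x, \sum_(d <- finsupp (hcomp x)) hcomp x d = x;
  hcomp_uniq : forall c : {fsfun 'rV[int]_n -> galg with 0},
    (forall d, c d \in homog d) -> hcomp (\sum_(d <- finsupp c) c d) = c;
  homog1 : 1 \in homog 0;
  homogM : forall d e x y,
    x \in homog d -> y \in homog e -> x * y \in homog (d + e)
}.

Arguments homog {K n} g d.

Definition graded_commutative (K : fieldType) n (A : gradedAlgebra K n) :=
  forall d e (x y : A), x \in homog A d -> y \in homog A e ->
    x * y = parity_sign K (pairing d e) *: (y * x).

Section Cochains.
Variables (K : fieldType) (n : nat) (A : gradedAlgebra K n).
Implicit Types (alpha w wF wG : 'rV[int]_n) (p q : nat).

(* Cochains are indexed by their number of arguments [p]; the second component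
   of the bidegree is [p - 1], so that for [p = 0] they are the elements of the
   algebra. *)
Definition cochain p := p.-tuple A -> A.

Definition adeg p : int := p%:Z - 1.

(* First component of the bidegree of a [p]-linear map of weight [w]. *)
Definition sdeg alpha w p : 'rV[int]_n := w + alpha *~ adeg p.

Definition tset p (u : p.-tuple A) (i : 'I_p) (x : A) : p.-tuple A :=
  [tuple if j == i then x else tnth u j | j < p].

Definition tswap p (u : p.-tuple A) (i j : 'I_p) : p.-tuple A :=
  [tuple tnth u (tperm i j k) | k < p].

Definition multilinear p (F : cochain p) :=
  forall (u : p.-tuple A) (i : 'I_p) (k : K) (x y : A),
    F (tset u i (k *: x + y)) = k *: F (tset u i x) + F (tset u i y).

Definition homogeneous p (u : p.-tuple A) (d : 'I_p -> 'rV[int]_n) :=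
  forall i, tnth u i \in homog A (d i).

Definition has_weight p w (F : cochain p) :=
  forall (u : p.-tuple A) (d : 'I_p -> 'rV[int]_n),
    homogeneous u d -> F u \in homog A (w + \sum_i d i).

Definition alpha_antisymmetric alpha p (F : cochain p) :=
  forall (u : p.-tuple A) (i j : 'I_p) (d e : 'rV[int]_n), j = i.+1 :> nat ->
    tnth u i \in homog A d -> tnth u j \in homog A e ->
    F (tswap u i j) = - parity_sign K (pairing (d + alpha) (e + alpha)) *: F u.

(* [last] is the last slot; the entry of [u] in that slot plays no role, and
   its degree [d last] is left out of the weight of [D]. *)
Definition first_order p w (F : cochain p) :=
  forall (u : p.-tuple A) (d : 'I_p -> 'rV[int]_n) (last : 'I_p),
    last.+1 = p -> (forall i, i != last -> tnth u i \in homog A (d i)) ->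
    let D x := F (tset u last x) in
    let wD := w + \sum_(i | i != last) d i in
    forall (e : 'rV[int]_n) (x y : A), x \in homog A e ->
      D (x * y) = D x * y + parity_sign K (pairing wD e) *: (x * D y) - D 1 * x * y.

(* For [p = 0] this is membership in the homogeneous component of degree [w]:
   the other three conditions are then vacuous. *)
Definition Diff1 alpha w p (F : cochain p) :=
  [/\ multilinear F, has_weight w F, alpha_antisymmetric alpha F & first_order w F].

Definition insert p (F : cochain p.+1) (v : A) : cochain p :=
  fun u => F [tuple of v :: u].

(* Only used on lists of size [p]. *)
Definition totuple p (s : seq A) : p.-tuple A := [tuple nth 0 s i | i < p].

(* Bracket of [F], of weight [wF], and [G], of weight [wG], evaluated on a list
   of [(p + q).-1] arguments. The inductive rule is stated for a homogeneous
   first argument and is extended linearly here, by summing over the homogeneous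
   components [x] of that argument. In the first branch the bracket lives in a
   zero space (there are no maps with [-1] arguments). *)
Fixpoint GM alpha p q wF wG (F : cochain p) (G : cochain q) (u : seq A)
    {struct u} : A :=
  match p, q return cochain p -> cochain q -> A with
  | 0, 0 => fun _ _ => 0
  | a.+1, 0 => fun F v =>
      parity_sign K (1 - a%:Z) *: insert F (v [tuple]) (totuple a u)
  | 0, a.+1 => fun v F =>
      - parity_sign K (pairing (wF - alpha) (wG + alpha *+ a) + a%:Z) *:
        (parity_sign K (1 - a%:Z) *: insert F (v [tuple]) (totuple a u))
  | a.+1, b.+1 => fun F G =>
      if u is v :: u' then
        \sum_(d <- finsupp (hcomp v))
          let x := hcomp v d in
          (parity_sign K a%:Z *: GM alpha wF (wG + d) F (insert G x) u' +
           parity_sign K (pairing (wG + alpha *+ b) (d - alpha)) *: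
             GM alpha (wF + d) wG (insert F x) G u')
      else 0
  end F G.

Fixpoint square alpha p q wF wG (F : cochain p) (G : cochain q) (u : seq A)
    {struct u} : A :=
  match p, q return cochain p -> cochain q -> A with
  | 0, _ => fun _ _ => 0
  | a.+1, 0 => fun F v =>
      parity_sign K (1 - a%:Z) *: insert F (v [tuple]) (totuple a u)
  | a.+1, b.+1 => fun F G =>
      if u is v :: u' then
        \sum_(d <- finsupp (hcomp v))
          let x := hcomp v d in
          (parity_sign K a%:Z *: square alpha wF (wG + d) F (insert G x) u' +
           parity_sign K (pairing (wG + alpha *+ b) (d - alpha)) *:
             square alpha (wF + d) wG (insert F x) G u')
      else 0
  end F G.

(* The entries of [u] with index in [I], in increasing order of index. *)
Definition subfamily m (u : m.-tuple A) (I : {set 'I_m}) : seq A :=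
  [seq tnth u i | i <- enum I].

(* The permutation whose one-line notation is [(I; J)]; the default value [1]
   is not reached when [I] and [J] partition the index set. *)
Definition shuffle m (I J : {set 'I_m}) : 'S_m :=
  insubd (1%g : 'S_m) [ffun k : 'I_m => nth k (enum I ++ enum J) k].

(* Sign [eps] such that x_1 ... x_m = eps x_(s 1) ... x_(s m) for graded
   commuting x_i of degrees [d i]. *)
Definition koszul m (d : 'I_m -> 'rV[int]_n) (s : 'S_m) : K :=
  \prod_(k < m) \prod_(l < m | (k < l)%N && (s l < s k)%N)
    parity_sign K (pairing (d (s k)) (d (s l))).

End Cochains.

(* Main.v *)
Require Import Defs.
From HB Require Import structures.
From mathcomp Require Import all_boot all_order all_algebra all_fingroup.
From mathcomp Require Import finmap.
From mathcomp Require Import ring zify.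

Set Implicit Arguments.
Unset Strict Implicit.
Unset Printing Implicit Defensive.

Import GRing.Theory.
Local Open Scope ring_scope.

(** The bracket identity is formal. Unfolding the recursive rules for [GM F G],
    [square F G] and [square G F] at a first argument [x] of degree [d], the
    two terms of [GM F G] are brackets of [F] with [G(x)] and of [F(x)] with
    [G], and the sign
    (-1)^(<A + alpha a, B + alpha b> + ab) changes, under these insertions,
    by exactly the coefficients that occur in the recursion of [square G F].
    So the identity follows by induction on the number of arguments
    ([GM_square]), from bilinearity of the pairing alone.

    For the explicit formula, let [shuffle_sum F G] be the signed sum over the
    subsets I of the index set (J being the complement of I). Splitting it
    according to whether the first index lies in I or in J produces the
    recursion that defines the square product ([shuffle_sum_cons]):
    - if it lies in I, the first argument v goes into the first slot of [G],
      with no sign;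
    - if it lies in J, moving v in front of the arguments indexed by I costs
      (-1)^|I| and the Koszul sign of v with their shifted degrees
      ([shuffle_sign_cons_setF]), and exchanging v with the value of [G] in
      the first two slots of [F] costs one alpha-antisymmetry sign. The degree
      of that value is the weight of [G] plus the degrees of the arguments in
      I, so the two dependences on these degrees cancel and only
      (-1)^(<B + alpha b, v - alpha> + b) is left.
    On permutations, both cases say that the shuffle attached to I is
    [lift_perm i ord0 s], where s is the shuffle of the remaining indices and i
    is 0 or |I| ([shuffle_cons_set]).

    The recursion for [square] decomposes its first argument into homogeneous
    components; [square_cons] reduces it to a single term when the argument is
    already homogeneous, and induction gives [square_shuffle_sum]. *)

(** * Subsets of an ordinal and their shuffles *)

(** Each subset of ['I_m.+1] is of this form for a unique pair [(b, I)], which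
    permits induction on the number of indices. *)
Definition cons_set m (b : bool) (I : {set 'I_m}) : {set 'I_m.+1} :=
  [set i | if unlift ord0 i is Some j then j \in I else b].

Lemma in_cons_set0 m b (I : {set 'I_m}) : (ord0 \in cons_set b I) = b.
Proof. by rewrite inE unlift_none. Qed.

Lemma in_cons_setS m b (I : {set 'I_m}) j :
  (lift ord0 j \in cons_set b I) = (j \in I).
Proof. by rewrite inE liftK. Qed.

Lemma setC_cons_set m b (I : {set 'I_m}) : ~: cons_set b I = cons_set (~~ b) (~: I).
Proof.
apply/setP=> i; rewrite !inE.
by case: (unliftP ord0 i) => [j|] _; rewrite ?inE.
Qed.

Lemma enum_cons_set m b (I : {set 'I_m}) :
  enum (cons_set b I) = nseq b ord0 ++ map (lift ord0) (enum I).
Proof.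
have enumE k (X : {set 'I_k}) : enum X = filter (mem X) (enum 'I_k) by rewrite enumT.
rewrite !enumE enum_ordSl /= in_cons_set0 filter_map.
rewrite (eq_filter (a2 := mem I)); last by move=> j; rewrite /= in_cons_setS.
by case: b.
Qed.

Lemma card_cons_set m b (I : {set 'I_m}) : #|cons_set b I| = (b + #|I|)%N.
Proof. by rewrite !cardE enum_cons_set size_cat size_nseq size_map. Qed.

Lemma big_cons_set (V : nmodType) m (P : pred {set 'I_m.+1}) (f : {set 'I_m.+1} -> V) :
  \sum_(I | P I) f I =
    \sum_(I | P (cons_set true I)) f (cons_set true I)
    + \sum_(I | P (cons_set false I)) f (cons_set false I).
Proof.
pose tl (I : {set 'I_m.+1}) := [set j | lift ord0 j \in I].
have tlK b (I : {set 'I_m.+1}) : (ord0 \in I) = b -> cons_set b (tl I) = I.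
  move=> I0; apply/setP=> i.
  case: (unliftP ord0 i) => [j|] ->; first by rewrite in_cons_setS inE.
  by rewrite in_cons_set0 I0.
have consK b (I : {set 'I_m}) : tl (cons_set b I) = I.
  by apply/setP=> j; rewrite inE in_cons_setS.
rewrite (bigID (fun I : {set _} => ord0 \in I)) /=; congr (_ + _).
  rewrite (reindex_onto (cons_set true) tl) => [|I /andP[_]]; last exact: tlK.
  by apply: eq_bigl => I; rewrite consK eqxx in_cons_set0 !andbT.
rewrite (reindex_onto (cons_set false) tl) => [|I /andP[_ /negbTE]]; last exact: tlK.
by apply: eq_bigl => I; rewrite consK eqxx in_cons_set0 !andbT.
Qed.

Lemma size_enum_setC m (I : {set 'I_m}) : size (enum I ++ enum (~: I)) = m.
Proof. by rewrite size_cat -!cardE cardsC card_ord. Qed.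

(** The sequence (I; complement of I) enumerates each index once, so the default
    permutation in the definition of [shuffle] is never taken. *)
Lemma shuffleE m (I : {set 'I_m}) (x k : 'I_m) :
  shuffle I (~: I) k = nth x (enum I ++ enum (~: I)) k.
Proof.
set s := enum I ++ _.
have szs : size s = m := size_enum_setC I.
have s_uniq : uniq s.
  rewrite cat_uniq !enum_uniq /= andbT -all_predC; apply/allP=> i.
  by rewrite !mem_enum inE => /negP ?; apply/negP; rewrite /= mem_enum.
have nthE i : nth i s i = nth x s i by apply: set_nth_default; rewrite szs.
rewrite -pvalE /shuffle [pval _]insubdK ?ffunE ?nthE //.
apply/injectiveP=> i j; rewrite !ffunE !nthE => /eqP.
by rewrite nth_uniq ?szs // => /eqP/val_inj.
Qed.

Lemma mem_shuffle m (I : {set 'I_m}) k : (shuffle I (~: I) k \in I) = (k < #|I|)%N.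
Proof.
rewrite (shuffleE I k k) nth_cat -cardE.
case: ltnP => [lt|ge]; first by rewrite -mem_enum mem_nth // -cardE.
apply/negbTE; rewrite -in_setC -mem_enum mem_nth //.
by rewrite -(ltn_add2l #|I|) subnKC // cardE -size_cat size_enum_setC.
Qed.

(** Adding the index [0] inserts the value [ord0] in the one-line notation: in
    front if [0] joins I, and right after the block of I if it joins the
    complement. *)
Lemma shuffle_cons_set m b (I : {set 'I_m}) :
  shuffle (cons_set b I) (~: cons_set b I)
    = lift_perm (inord (if b then 0 else #|I|)) ord0 (shuffle I (~: I)).
Proof.
set i0 := inord _.
have i0E : i0 = (if b then 0 else #|I|)%N :> nat.
  rewrite inordK // ltnS; case: b {i0} => //.
  by rewrite -[m in (_ <= m)%N]card_ord max_card.
set L := enum I ++ enum (~: I); have szL : size L = m := size_enum_setC I.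
have enumE : enum (cons_set b I) ++ enum (~: cons_set b I)
    = take i0 (map (lift ord0) L) ++ ord0 :: drop i0 (map (lift ord0) L).
  rewrite setC_cons_set !enum_cons_set i0E; case: b {i0 i0E} => /=.
    by rewrite take0 drop0 -map_cat.
  by rewrite map_cat take_size_cat ?drop_size_cat // size_map cardE.
have szt : size (take i0 (map (lift ord0) L)) = i0.
  by rewrite size_take size_map szL; case: ltnP => // ?; have := ltn_ord i0; lia.
apply/permP=> k; rewrite (shuffleE _ ord0) enumE nth_cat szt.
case: (unliftP i0 k) => [k'|] ->; last first.
  by rewrite lift_perm_id ltnn subnn.
rewrite lift_perm_lift (shuffleE I k' k').
rewrite -/L -(nth_map _ ord0) ?szL //= /bump.
case: (leqP i0 k') => le.
  rewrite add1n ltnNge leqW //= subSn //= nth_drop subnKC //.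
by rewrite add0n le nth_take.
Qed.

(** * Parity signs and Koszul signs *)

(** Position [i] carries the smallest value, so it is inverted with exactly the
    positions before it; all other inversions are those of [s]. *)
Lemma koszul_lift_perm (K : fieldType) n m (d : 'I_m.+1 -> 'rV[int]_n) i (s : 'S_m) :
  koszul K d (lift_perm i ord0 s) =
    koszul K (fun j => d (lift ord0 j)) s
    * \prod_(k < m | (k < i)%N) parity_sign K (pairing (d (lift ord0 (s k))) (d ord0)).
Proof.
rewrite /koszul (bigD1_ord i) //= big1 ?mul1r; last first.
  by move=> l /andP[_]; rewrite lift_perm_id ltn0.
rewrite [X in _ = _ * X]big_mkcond -big_split; apply: eq_bigr => k _ /=.
have lt_lift (h : 'I_m.+1) (j j' : 'I_m) : (lift h j < lift h j')%N = (j < j')%N.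
  rewrite /= /bump; case: (leqP h j); case: (leqP h j') => /= ? ?;
    by rewrite ?addSn ?add0n; lia.
have lt_lift_pivot : (lift i k < i)%N = (k < i)%N.
  by rewrite /= /bump; case: (leqP i k) => /=; rewrite ?add1n ?add0n; lia.
rewrite big_mkcond (bigD1_ord i) //= -big_mkcond mulrC.
rewrite [(bump i k < i)%N]lt_lift_pivot lift_perm_id lift_perm_lift andbT.
congr (_ * _); apply: eq_big => l.
  by rewrite [(bump i k < bump i l)%N]lt_lift !lift_perm_lift lt_lift.
by rewrite !lift_perm_lift.
Qed.

Section Signs.
Variables (K : fieldType) (n : nat).
Implicit Types (x y : int) (d e f : 'rV[int]_n).

Lemma pairingC d e : pairing d e = pairing e d.
Proof. by apply: eq_bigr => i _; rewrite mulrC. Qed.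

Lemma pairingDl d e f : pairing (d + e) f = pairing d f + pairing e f.
Proof. by rewrite -big_split; apply: eq_bigr => i _; rewrite mxE mulrDl. Qed.

Lemma pairingNl d e : pairing (- d) e = - pairing d e.
Proof. by rewrite -sumrN; apply: eq_bigr => i _; rewrite mxE mulNr. Qed.

Lemma pairingMnl d e k : pairing (d *+ k) e = k%:Z * pairing d e.
Proof.
elim: k => [|k IHk].
  by rewrite mulr0n mul0r; apply: big1 => i _; rewrite mxE mul0r.
by rewrite mulrS pairingDl IHk intS mulrDl mul1r.
Qed.

Lemma pairingDr d e f : pairing f (d + e) = pairing f d + pairing f e.
Proof. by rewrite !(pairingC f) pairingDl. Qed.

Lemma pairingNr d e : pairing e (- d) = - pairing e d.
Proof. by rewrite !(pairingC e) pairingNl. Qed.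

Lemma pairingMnr d e k : pairing e (d *+ k) = k%:Z * pairing e d.
Proof. by rewrite !(pairingC e) pairingMnl. Qed.

Definition pairingE := (pairingDl, pairingDr, pairingNl, pairingNr, pairingMnl, pairingMnr).

Lemma parity_signD x y : parity_sign K (x + y) = parity_sign K x * parity_sign K y.
Proof. by rewrite /parity_sign expfzDr // oppr_eq0 oner_eq0. Qed.

Lemma parity_sign0 : parity_sign K 0 = 1. Proof. exact: expr0z. Qed.

Lemma parity_sign1 : parity_sign K 1 = -1. Proof. exact: expr1z. Qed.

Lemma parity_sign_even x : parity_sign K (x + x) = 1.
Proof.
by rewrite -mulr2n -mulr_natl /parity_sign -exprz_exp [_ ^ 2%:R]sqrrN expr1n exp1rz.
Qed.

(** The witness [z] turns an equality of signs into an identity of integers. *)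
Lemma eq_parity_sign z x y : x = y + (z + z) -> parity_sign K x = parity_sign K y.
Proof. by move=> ->; rewrite parity_signD parity_sign_even mulr1. Qed.

Lemma parity_signN x : - parity_sign K x = parity_sign K (x + 1).
Proof. by rewrite parity_signD parity_sign1 mulrN1. Qed.

Lemma prod_parity_sign (I : finType) (P : pred I) (f : I -> int) :
  \prod_(i | P i) parity_sign K (f i) = parity_sign K (\sum_(i | P i) f i).
Proof. by rewrite (big_morph _ parity_signD parity_sign0). Qed.

Lemma pairing_suml (I : finType) (P : pred I) (f : I -> 'rV[int]_n) e :
  pairing (\sum_(i | P i) f i) e = \sum_(i | P i) pairing (f i) e.
Proof.
apply: (big_morph (fun d => pairing d e) (fun d1 d2 => pairingDl d1 d2 e)).
by apply: big1 => i _; rewrite mxE mul0r.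
Qed.

(** The graded signature of the permutation (I; complement of I). *)
Definition shuffle_sign m (d : 'I_m -> 'rV[int]_n) (I : {set 'I_m}) : K :=
  (-1) ^+ odd_perm (shuffle I (~: I)) * koszul K d (shuffle I (~: I)).

Lemma shuffle_sign_cons_setT m (d : 'I_m.+1 -> 'rV[int]_n) (I : {set 'I_m}) :
  shuffle_sign d (cons_set true I) = shuffle_sign (fun i => d (lift ord0 i)) I.
Proof.
rewrite /shuffle_sign shuffle_cons_set odd_lift_perm koszul_lift_perm.
by rewrite inordK //= [X in _ * (_ * X)]big_pred0 ?mulr1 // => k; rewrite ltn0.
Qed.

(** Sign of moving the first argument past those indexed by I: the first |I|
    values of the shuffle are the elements of I, so the product over positions
    in [koszul_lift_perm] becomes one over I. *)
Lemma shuffle_sign_cons_setF m (d : 'I_m.+1 -> 'rV[int]_n) (I : {set 'I_m}) :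
  shuffle_sign d (cons_set false I) =
    parity_sign K (#|I|%:Z + pairing (\sum_(i in I) d (lift ord0 i)) (d ord0))
    * shuffle_sign (fun i => d (lift ord0 i)) I.
Proof.
rewrite /shuffle_sign shuffle_cons_set odd_lift_perm koszul_lift_perm.
rewrite inordK; last by rewrite ltnS -[m in (_ <= m)%N]card_ord max_card.
rewrite addbF signr_addb signr_odd parity_signD -/(parity_sign K #|I|%:Z).
rewrite pairing_suml -prod_parity_sign.
rewrite [koszul _ _ _ * _]mulrC mulrACA; congr (_ * _ * _).
rewrite [RHS](reindex_inj (@perm_inj _ (shuffle I (~: I)))) /=.
by apply: eq_bigl => k; rewrite mem_shuffle.
Qed.
End Signs.

(** * Cochains with a fixed first argument, and the recursion for [square] *)

Section Square.
Variables (K : fieldType) (n : nat) (A : gradedAlgebra K n) (alpha : 'rV[int]_n).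
Implicit Types (v x y : A) (s : seq A) (w d e wF wG : 'rV[int]_n).

Lemma homog0 d : 0 \in homog A d.
Proof. by case: (@homog_submod _ _ A d). Qed.

(** The homogeneous decomposition of [v] is concentrated in degree [d], by its
    uniqueness. For [v = 0] its support is empty rather than [[fset d]], hence
    the hypothesis on [f]. *)
Lemma sum_hcomp_homog v d (f : 'rV[int]_n -> A -> A) :
    v \in homog A d -> f d 0 = 0 ->
  \sum_(e <- finsupp (hcomp v)) f e (hcomp v e) = f d v.
Proof.
move=> vd fd0; pose c : {fsfun 'rV[int]_n -> A with 0} := [fsfun [fsfun] with d |-> v].
have cE e : c e = if e == d then v else 0 by rewrite fsfun_withE fsfun0E.
have finsuppE : finsupp c = if v == 0 then fset0 else [fset d]%fset.
  by rewrite finsupp_with finsupp0 fset0D fsetU0.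
have c_sum : \sum_(e <- finsupp c) c e = v.
  rewrite finsuppE; case: eqP => [->|_]; first by rewrite big_seq_fset0.
  by rewrite big_seq_fset1 cE eqxx.
have -> : hcomp v = c.
  rewrite -c_sum hcomp_uniq // => e; rewrite cE.
  by case: eqP => [->|_] //; exact: homog0.
rewrite finsuppE; case: eqP => [->|_]; first by rewrite big_seq_fset0.
by rewrite big_seq_fset1 cE eqxx.
Qed.

Lemma totuple_cons p x s : totuple p.+1 (x :: s) = [tuple of x :: totuple p s].
Proof.
apply: eq_from_tnth => i; rewrite tnth_mktuple.
by case: (unliftP ord0 i) => [j|] ->; rewrite ?tnth0 // tnthS tnth_mktuple.
Qed.

Lemma subfamily_cons m v (u : m.-tuple A) b (I : {set 'I_m}) :
  subfamily [tuple of v :: u] (cons_set b I) = nseq b v ++ subfamily u I.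
Proof.
rewrite /subfamily enum_cons_set map_cat map_nseq tnth0 -map_comp.
by congr (_ ++ _); apply: eq_map => i; rewrite /= tnthS.
Qed.

Lemma tset_cons p v (u : p.-tuple A) i x :
  tset [tuple of v :: u] (lift ord0 i) x = [tuple of v :: tset u i x].
Proof.
apply: eq_from_tnth => j; rewrite tnth_mktuple.
case: (unliftP ord0 j) => [k|] ->; last by rewrite !tnth0.
by rewrite (inj_eq lift_inj) !tnthS tnth_mktuple.
Qed.

Lemma tswap_cons p v (u : p.-tuple A) i j :
  tswap [tuple of v :: u] (lift ord0 i) (lift ord0 j) = [tuple of v :: tswap u i j].
Proof.
apply: eq_from_tnth => k; rewrite tnth_mktuple.
case: (unliftP ord0 k) => [l|] ->; last by rewrite tpermD // !tnth0.
by rewrite -inj_tperm ?tnthS ?tnth_mktuple //; exact: lift_inj.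
Qed.

Lemma multilinear_insert p (F : cochain A p.+1) v :
  multilinear F -> multilinear (insert F v).
Proof. by move=> Fl u i k x y; rewrite /insert -!tset_cons Fl. Qed.

Lemma has_weight_insert p w d (F : cochain A p.+1) v :
  v \in homog A d -> has_weight w F -> has_weight (w + d) (insert F v).
Proof.
move=> vd Fw u e ue.
pose e' (i : 'I_p.+1) := if unlift ord0 i is Some j then e j else d.
have e'0 : e' ord0 = d by rewrite /e' unlift_none.
have e'S j : e' (lift ord0 j) = e j by rewrite /e' liftK.
have := Fw [tuple of v :: u] e'; rewrite big_ord_recl e'0 addrA.
rewrite (eq_bigr e) => [|j _]; last exact: e'S.
apply=> i; case: (unliftP ord0 i) => [j|] ->; first by rewrite tnthS e'S.
by rewrite tnth0 e'0.
Qed.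

Lemma alpha_antisymmetric_insert p (F : cochain A p.+1) v :
  alpha_antisymmetric alpha F -> alpha_antisymmetric alpha (insert F v).
Proof.
move=> Fa u i j d e ij ud ue.
rewrite /insert -tswap_cons; apply: Fa; rewrite ?tnthS //.
by rewrite /= /bump /= !add1n ij.
Qed.

Lemma multilinear_cons0 p (F : cochain A p.+1) (u : p.-tuple A) :
  multilinear F -> F [tuple of 0 :: u] = 0.
Proof.
move=> Fl; have := Fl [tuple of 0 :: u] ord0 1 0 0.
have tset0 x : tset [tuple of 0 :: u] ord0 x = [tuple of x :: u].
  apply: eq_from_tnth => i; rewrite tnth_mktuple.
  by case: (unliftP ord0 i) => [j|] ->; rewrite ?tnth0 // !tnthS.
by rewrite !tset0 !scale1r addr0 -[LHS]addr0 => /addrI.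
Qed.

(** [G] only enters through an argument of [F], and a multilinear [F] vanishes
    when that argument does. *)
Lemma square_eq0 p q wF wG (F : cochain A p) (G : cochain A q) s :
    multilinear F -> F =1 (fun=> 0) \/ G =1 (fun=> 0) ->
  square alpha wF wG F G s = 0.
Proof.
elim: s p q wF wG F G => [|v s IHs] [|a] [|b] wF wG F G Fl FG0 //=.
- case: FG0 => FG0; first by rewrite /insert FG0 scaler0.
  by rewrite FG0 /insert multilinear_cons0 // scaler0.
- case: FG0 => FG0; first by rewrite /insert FG0 scaler0.
  by rewrite FG0 /insert multilinear_cons0 // scaler0.
apply: big1 => d _; rewrite !IHs ?scaler0 ?addr0 //; first exact: multilinear_insert.
  by case: FG0 => FG0; [left | right] => u; rewrite /insert FG0.
by case: FG0 => FG0; [left | right] => u; rewrite /insert FG0.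
Qed.

(** The defining rule of the square product for a homogeneous argument [v];
    multilinearity is what makes it valid also for [v = 0]. *)
Lemma square_cons p q wF wG d (F : cochain A p.+1) (G : cochain A q.+1) v s :
    multilinear F -> multilinear G -> v \in homog A d ->
  square alpha wF wG F G (v :: s) =
    parity_sign K p%:Z *: square alpha wF (wG + d) F (insert G v) s
    + parity_sign K (pairing (wG + alpha *+ q) (d - alpha)) *:
      square alpha (wF + d) wG (insert F v) G s.
Proof.
move=> Fl Gl vd.
apply: (sum_hcomp_homog (f := fun e x =>
  parity_sign K p%:Z *: square alpha wF (wG + e) F (insert G x) s
  + parity_sign K (pairing (wG + alpha *+ q) (e - alpha)) *:
    square alpha (wF + e) wG (insert F x) G s) vd).
rewrite !square_eq0 ?scaler0 ?addr0 //; first exact: multilinear_insert.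
  by left=> u; exact: multilinear_cons0.
by right=> u; exact: multilinear_cons0.
Qed.

(** Inserting [x] into [G] changes the exponent of the commutation sign exactly
    as the recursion of [square G F] does; inserting it into [F] does so up to
    twice the pairing of the shifted degree of [x] with the bidegree of [G], and
    up to [2 * adeg q]. *)
Lemma GM_square p q wF wG (F : cochain A p) (G : cochain A q) s :
  GM alpha wF wG F G s =
    square alpha wF wG F G s
    - parity_sign K (pairing (sdeg alpha wF p) (sdeg alpha wG q) + adeg p * adeg q)
      *: square alpha wG wF G F s.
Proof.
have sdegE w k : sdeg alpha w k = w + alpha *+ k - alpha.
  by rewrite /sdeg /adeg mulrzBr mulr1z addrA.
elim: s p q wF wG F G => [|v s IHs] [|a] [|b] wF wG F G //=;
  rewrite ?scaler0 ?subr0 ?sub0r ?scaleNr //.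
1,2: congr (- (_ *: _)); apply: (@eq_parity_sign _ b%:Z).
1,2: by rewrite !sdegE /adeg !pairingE intS; ring.
rewrite scaler_sumr -sumrB; apply: eq_bigr => d _.
rewrite !IHs !scalerBr !scalerDr !scalerA -!parity_signD.
rewrite addrACA -opprD; congr (_ - _).
(* Inserting into one factor of [GM F G] is inserting into the other factor of
   [square G F], hence the exchange of the two terms. *)
rewrite addrC /adeg !sdegE !intS; congr (_ *: _ + _ *: _).
  apply: (@eq_parity_sign _ (pairing (wG + alpha *+ b) (d - alpha) - b%:Z)).
  by rewrite !pairingE !intS (pairingC d) (pairingC d alpha) (pairingC alpha wG); ring.
by congr (parity_sign K _); rewrite !pairingE !intS; ring.
Qed.

(** * The explicit form of the square product *)

Definition shuffle_term p q (F : cochain A p) (G : cochain A q)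
    m (u : m.-tuple A) (d : 'I_m -> 'rV[int]_n) (I : {set 'I_m}) : A :=
  shuffle_sign K (fun i => d i - alpha) I *:
    F (totuple p (G (totuple q (subfamily u I)) :: subfamily u (~: I))).

(** With the successor on the side of the complement, the sum is empty for
    [p = 0], where the number [p - 1] of remaining arguments would be -1. *)
Definition shuffle_sum p q (F : cochain A p) (G : cochain A q)
    m (u : m.-tuple A) (d : 'I_m -> 'rV[int]_n) : A :=
  \sum_(I : {set 'I_m} | (#|I| == q) && (#|~: I|.+1 == p)) shuffle_term F G u d I.

Lemma alpha_antisymmetric_swap p (F : cochain A p.+2) x y s d e :
    alpha_antisymmetric alpha F -> x \in homog A d -> y \in homog A e ->
  F (totuple p.+2 [:: y, x & s])
    = - parity_sign K (pairing (d + alpha) (e + alpha)) *: F (totuple p.+2 [:: x, y & s]).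
Proof.
move=> Fa xd ye; pose i1 : 'I_p.+2 := lift ord0 ord0.
rewrite -(Fa (totuple p.+2 [:: x, y & s]) ord0 i1) ?tnth_mktuple //.
congr F; apply: eq_from_tnth => k; rewrite !tnth_mktuple.
by case: tpermP => [->|->|/eqP k0 /eqP k1] //; case: k k0 k1 => [[|[|k]] ?].
Qed.

(** Homogeneity of the value of [G] is what allows the antisymmetry of [F] to be
    applied to it. *)
Lemma has_weight_subfamily q w (G : cochain A q) m (u : m.-tuple A)
    (d : 'I_m -> 'rV[int]_n) (I : {set 'I_m}) :
    has_weight w G -> homogeneous u d -> #|I| = q ->
  G (totuple q (subfamily u I)) \in homog A (w + \sum_(i in I) d i).
Proof.
move=> Gw ud Iq; case: q / Iq G Gw => G Gw.
rewrite big_enum_val; apply: Gw => k; rewrite tnth_mktuple.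
rewrite (nth_map (enum_val k)) -?cardE // -enum_val_nth; exact: ud.
Qed.

(** Splitting on the side of the first index gives the recursion of [square], up
    to the prefactor (-1)^(1 + ab). *)
Lemma shuffle_sum_cons p q wG (F : cochain A p.+1) (G : cochain A q.+1)
    m v (u : m.-tuple A) (d : 'I_m.+1 -> 'rV[int]_n) :
    has_weight wG G -> alpha_antisymmetric alpha F ->
    homogeneous [tuple of v :: u] d ->
  shuffle_sum F G [tuple of v :: u] d =
    shuffle_sum F (insert G v) u (fun i => d (lift ord0 i))
    + parity_sign K (pairing (wG + alpha *+ q) (d ord0 - alpha) + q%:Z) *:
      shuffle_sum (insert F v) G u (fun i => d (lift ord0 i)).
Proof.
move=> Gw Fa vud; rewrite /shuffle_sum big_cons_set; congr (_ + _).
  apply: eq_big => I.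
    by rewrite setC_cons_set !card_cons_set ?add0n ?add1n ?eqSS.
  move=> _; rewrite /shuffle_term shuffle_sign_cons_setT setC_cons_set.
  by rewrite !subfamily_cons /insert -totuple_cons.
rewrite scaler_sumr; apply: eq_big => I.
  by rewrite setC_cons_set !card_cons_set ?add0n ?add1n ?eqSS.
rewrite setC_cons_set !card_cons_set ?add0n ?add1n ?eqSS => /andP[/eqP Iq /eqP Ip].
rewrite /shuffle_term shuffle_sign_cons_setF setC_cons_set.
rewrite !subfamily_cons /=; case: p Ip F Fa => [|p] //= _ F Fa.
have ud : homogeneous u (fun i => d (lift ord0 i)).
  by move=> i; have := vud (lift ord0 i); rewrite tnthS.
have vd : v \in homog A (d ord0) by have := vud ord0; rewrite tnth0.
rewrite (alpha_antisymmetric_swap _ Fa vd (has_weight_subfamily Gw ud Iq)).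
rewrite totuple_cons !scalerA; congr (_ *: _).
rewrite parity_signN mulrAC -parity_signD Iq; congr (_ * _).
have -> : \sum_(i in I) (d (lift ord0 i) - alpha)
    = \sum_(i in I) d (lift ord0 i) - alpha *+ q.+1.
  by rewrite sumrB sumr_const Iq.
set S := \sum_(i in I) _.
(* [pairing S (d ord0)] occurs once from moving [v] past I and once from the
   exchange in [F], hence an even number of times. *)
apply: (@eq_parity_sign _ (pairing S (d ord0) - q%:Z * pairing alpha (d ord0)
  + pairing alpha wG + (q%:Z + 1) * pairing alpha alpha + 1)).
rewrite !pairingE !intS !(pairingC (d ord0)) (pairingC alpha S) (pairingC alpha wG).
by ring.
Qed.

Lemma shuffle_sum0 p (F : cochain A p) (G : cochain A 0) m
    (u : m.-tuple A) (d : 'I_m -> 'rV[int]_n) :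
  m.+1 = p -> shuffle_sum F G u d = F (totuple p (G [tuple] :: u)).
Proof.
move=> mp; rewrite /shuffle_sum (big_pred1 set0) => [|I]; last first.
  rewrite cards_eq0 /= andb_idr // => /eqP ->.
  by rewrite setC0 cardsT card_ord mp.
have shuffle1 : shuffle set0 (~: set0 : {set 'I_m}) = 1%g.
  apply/permP=> k.
  by rewrite (shuffleE _ k) perm1 enum_set0 setC0 enum_setT -enumT nth_ord_enum.
have koszul1 (f : 'I_m -> 'rV[int]_n) : koszul K f 1 = 1.
  rewrite /koszul big1 // => k _; apply: big1 => l /andP[kl].
  by rewrite !perm1 ltnNge ltnW.
rewrite /shuffle_term /shuffle_sign shuffle1 odd_perm1 koszul1 mulr1 scale1r.
rewrite /subfamily setC0 enum_set0 enum_setT -enumT map_tnth_enum.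
by rewrite (tuple0 (totuple 0 _)).
Qed.

Lemma square_source0 q wF wG (F : cochain A 0) (G : cochain A q) s :
  square alpha wF wG F G s = 0.
Proof. by case: s. Qed.

Lemma square_target0 p wF wG (F : cochain A p.+1) (G : cochain A 0) s :
  square alpha wF wG F G s
    = parity_sign K (1 - p%:Z) *: F (totuple p.+1 (G [tuple] :: s)).
Proof. by case: s => [|v s] /=; rewrite totuple_cons. Qed.

Lemma square_shuffle_sum p q wF wG (F : cochain A p) (G : cochain A q) m
    (u : m.-tuple A) (d : 'I_m -> 'rV[int]_n) :
    multilinear F -> alpha_antisymmetric alpha F ->
    multilinear G -> has_weight wG G ->
    m = (p + q).-1 -> homogeneous u d ->
  square alpha wF wG F G u
    = parity_sign K (1 + adeg p * adeg q) *: shuffle_sum F G u d.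
Proof.
elim: m p q wF wG F G u d => [|m IHm] [|a] q wF wG F G u d Fl Fa Gl Gw mE ud.
1,3: by rewrite square_source0 /shuffle_sum big_pred0 ?scaler0 // => I; rewrite andbF.
  case: q G Gl Gw mE => [|b] G Gl Gw mE; last by rewrite addnS in mE.
  rewrite square_target0 shuffle_sum0; last by move: mE; rewrite addn0 => /= ->.
  by congr (_ *: _); congr parity_sign; rewrite /adeg intS; ring.
case: q G Gl Gw mE => [|b] G Gl Gw mE.
  rewrite square_target0 shuffle_sum0; last by move: mE; rewrite addn0 => /= ->.
  by congr (_ *: _); congr parity_sign; rewrite /adeg intS; ring.
case/tupleP: u ud => v u vud.
have ud : homogeneous u (fun i => d (lift ord0 i)).
  by move=> i; have := vud (lift ord0 i); rewrite tnthS.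
have vd : v \in homog A (d ord0) by have := vud ord0; rewrite tnth0.
rewrite (square_cons _ _ _ Fl Gl vd) (shuffle_sum_cons Gw Fa vud).
have mE1 : m = (a.+1 + b).-1 by move: mE; rewrite addnS => -[].
have mE2 : m = (a + b.+1).-1 by rewrite mE1 addnS.
have Gvw := has_weight_insert vd Gw; have Fva := alpha_antisymmetric_insert v Fa.
rewrite (IHm _ _ _ _ _ _ _ _ Fl Fa (multilinear_insert v Gl) Gvw mE1 ud).
rewrite (IHm _ _ _ _ _ _ _ _ (multilinear_insert v Fl) Fva Gl Gw mE2 ud).
rewrite scalerDr !scalerA -!parity_signD /adeg !intS; congr (_ *: _ + _ *: _).
  by congr parity_sign; ring.
apply: (@eq_parity_sign _ (- b%:Z)); ring.
Qed.
End Square.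

Theorem proposition12 (K : fieldType) (charK0 : [pchar K] =i pred0) (n : nat)
  (A : gradedAlgebra K n) (Acomm : graded_commutative A)
  (alpha : 'rV[int]_n) (p q : nat) (wF wG : 'rV[int]_n)
  (F : cochain A p) (G : cochain A q)
  (DF : Diff1 alpha wF F) (DG : Diff1 alpha wG G) :
  let a := adeg p in
  let b := adeg q in
  (forall u : ((p + q).-1).-tuple A,
     GM alpha wF wG F G u =
       square alpha wF wG F G u
       - parity_sign K (pairing (sdeg alpha wF p) (sdeg alpha wG q) + a * b) *:
           square alpha wG wF G F u)
  /\
  (forall (u : ((p + q).-1).-tuple A) (d : 'I_((p + q).-1) -> 'rV[int]_n),
     homogeneous u d ->
     square alpha wF wG F G u =
       parity_sign K (1 + a * b) *:
       \sum_(IJ : {set 'I_((p + q).-1)} * {set 'I_((p + q).-1)} |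
              [&& [disjoint IJ.1 & IJ.2], IJ.1 :|: IJ.2 == setT,
                  #|IJ.1|%:Z == b + 1 & #|IJ.2|%:Z == a])
         ((-1) ^+ odd_perm (shuffle IJ.1 IJ.2)
          * koszul K (fun i => d i - alpha) (shuffle IJ.1 IJ.2)) *:
         F (totuple p (G (totuple q (subfamily u IJ.1)) :: subfamily u IJ.2))).
Proof.
move=> a b; split=> [u|u d ud]; first exact: GM_square.
have [Fl _ Fa _] := DF; have [Gl Gw _ _] := DG.
rewrite (square_shuffle_sum _ Fl Fa Gl Gw erefl ud); congr (_ *: _).
(* A pair (I, J) in the index set is determined by I. *)
rewrite [RHS](reindex_onto (fun I => (I, ~: I)) fst) => [|[I J] /=].
  apply: eq_bigl => I /=; rewrite disjoints_subset setCK subxx setUCr !eqxx andbT /=.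
  by rewrite /a /b /adeg subrK eqz_nat -subr_eq opprK addrC -intS eqz_nat.
case/and4P; rewrite disjoints_subset => IJ /eqP IJT _ _; congr (_, _); apply/eqP.
rewrite eqEsubset; apply/andP; split; last by rewrite subsetC.
by apply/subsetP=> i; have := in_setT i; rewrite -IJT !inE => /orP[->|].
Qed.
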